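(* A variety of modal Heyting algebras is semisimple if and only if there is some $n\in\omega$ such that it satisfies both $1\approx x\vee\Box_1\neg\Box_n x$ and $\Box_n x\leq\Box_{n+1}x$.
   Context: A modal Heyting algebra is a Heyting algebra (with top element $1=\top$ and bottom element $\bot$) with unary operators $\Box,\Diamond$ satisfying $\Box(x\wedge y)\approx\Box x\wedge\Box y$, $\Box\top\approx\top$, $\Diamond(x\vee y)\approx\Diamond x\vee\Diamond y$, $\Diamond\bot\approx\bot$, $\Box(x\rightarrow y)\leq\Diamond x\rightarrow\Diamond y$, and $\Diamond x\rightarrow\Box y\leq\Box(x\rightarrow y)$. Notation: $\neg x:=x\rightarrow\bot$ and $\Box_n x:=x\wedge\Box x\wedge\cdots\wedge\Box^n x$, where $\Box^n$ is a string of $n$ boxes. A variety of modal Heyting algebras is a class of modal Heyting algebras axiomatized by equations. An algebra is simple if it has exactly two congruences; it is semisimple if it is a subdirect product of (a possibly empty family of) simple algebras, equivalently if the equality relation is the intersection of all maximal non-trivial congruences. A variety is semisimple if each algebra in it is semisimple. *)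

(* Defs.v *)
(* Vanilla Stdlib development. *)
From Stdlib Require Import RelationClasses Morphisms Relation_Definitions FinFun.

Set Implicit Arguments.
Unset Strict Implicit.

(* The lattice order is [x <= y := meet x y = x]; it is unfolded in the
   record because it is only introduced below. *)
Record modalHeyting : Type := ModalHeyting {
  carrier :> Type;
  bot : carrier;
  top : carrier;
  meet : carrier -> carrier -> carrier;
  join : carrier -> carrier -> carrier;
  imp : carrier -> carrier -> carrier;
  box : carrier -> carrier;
  dia : carrier -> carrier;
  meetA : forall x y z, meet x (meet y z) = meet (meet x y) z;
  meetC : forall x y, meet x y = meet y x;
  joinA : forall x y z, join x (join y z) = join (join x y) z;
  joinC : forall x y, join x y = join y x;
  meet_joinK : forall x y, meet x (join x y) = x;
  join_meetK : forall x y, join x (meet x y) = x;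
  meet_bot : forall x, meet bot x = bot;
  meet_top : forall x, meet x top = x;
  imp_residual : forall x y z,
    meet (meet z x) y = meet z x <-> meet z (imp x y) = z;
  box_meet : forall x y, box (meet x y) = meet (box x) (box y);
  box_top : box top = top;
  dia_join : forall x y, dia (join x y) = join (dia x) (dia y);
  dia_bot : dia bot = bot;
  box_imp_le : forall x y,
    meet (box (imp x y)) (imp (dia x) (dia y)) = box (imp x y);
  dia_imp_le : forall x y,
    meet (imp (dia x) (box y)) (box (imp x y)) = imp (dia x) (box y)
}.

Arguments bot {m}.
Arguments top {m}.

Inductive term : Type :=
| Var (i : nat)
| Bot
| Top
| Meet (s t : term)
| Join (s t : term)
| Imp (s t : term)
| Box (t : term)
| Dia (t : term).

Fixpoint eval (A : modalHeyting) (v : nat -> A) (t : term) : A :=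
  match t with
  | Var i => v i
  | Bot => bot
  | Top => top
  | Meet s t => meet (eval v s) (eval v t)
  | Join s t => join (eval v s) (eval v t)
  | Imp s t => imp (eval v s) (eval v t)
  | Box t => box (eval v t)
  | Dia t => dia (eval v t)
  end.

Definition equation : Type := (term * term)%type.

Declare Scope mha_scope.
Delimit Scope mha_scope with mha.
Notation "s ≈ t" := ((s, t) : equation) (at level 70) : mha_scope.
Notation "s ≤ t" := ((Meet s t, s) : equation) (at level 70) : mha_scope.

Definition satisfies (A : modalHeyting) (e : equation) : Prop :=
  forall v : nat -> A, eval v (fst e) = eval v (snd e).

Definition class_satisfies (K : modalHeyting -> Prop) (e : equation) : Prop :=
  forall A : modalHeyting, K A -> satisfies A e.

Definition is_variety (K : modalHeyting -> Prop) : Prop :=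
  exists Sigma : equation -> Prop,
    forall A : modalHeyting, K A <-> (forall e, Sigma e -> satisfies A e).

Definition Neg (t : term) : term := Imp t Bot.

Fixpoint Boxes (n : nat) (t : term) : term :=
  match n with
  | O => t
  | S k => Meet (Boxes k t) (Nat.iter n Box t)
  end.

Record hom (A B : modalHeyting) (f : A -> B) : Prop := Hom {
  hom_bot : f bot = bot;
  hom_top : f top = top;
  hom_meet : forall x y, f (meet x y) = meet (f x) (f y);
  hom_join : forall x y, f (join x y) = join (f x) (f y);
  hom_imp : forall x y, f (imp x y) = imp (f x) (f y);
  hom_box : forall x, f (box x) = box (f x);
  hom_dia : forall x, f (dia x) = dia (f x)
}.

Record congruence (A : modalHeyting) (theta : relation A) : Prop := Congruence {
  cong_equiv : Equivalence theta;
  cong_meet : Proper (theta ==> theta ==> theta) (@meet A);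
  cong_join : Proper (theta ==> theta ==> theta) (@join A);
  cong_imp : Proper (theta ==> theta ==> theta) (@imp A);
  cong_box : Proper (theta ==> theta) (@box A);
  cong_dia : Proper (theta ==> theta) (@dia A)
}.

(* Exactly two congruences, relations being compared extensionally; the
   one-element algebra has only one and is therefore not simple. *)
Definition simple (A : modalHeyting) : Prop :=
  exists theta1 theta2 : relation A,
    congruence theta1 /\ congruence theta2 /\
    ~ relation_equivalence theta1 theta2 /\
    forall theta : relation A, congruence theta ->
      relation_equivalence theta theta1 \/ relation_equivalence theta theta2.

(* [h] embeds [A] into the product of the [B i], whose operations are
   componentwise, and every projection of the image is onto.  For empty [I]
   the product is the one-element algebra. *)
Definition subdirect_product (A : modalHeyting) (I : Type)
    (B : I -> modalHeyting) : Prop :=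
  exists h : A -> forall i : I, B i,
    (forall i, hom (fun a => h a i)) /\
    Injective h /\
    (forall i, Surjective (fun a => h a i)).

Definition semisimple (A : modalHeyting) : Prop :=
  exists (I : Type) (B : I -> modalHeyting),
    (forall i, simple (B i)) /\ subdirect_product A B.

Definition class_semisimple (K : modalHeyting -> Prop) : Prop :=
  forall A : modalHeyting, K A -> semisimple A.

(* Main.v *)
(** (⇐) The open filters of an algebra correspond to its congruences.  The two
    equations make every [boxes n x] an open element with an open complement,
    so an open filter that is maximal among those avoiding some [d] is a
    maximal filter.

    (⇒) In a simple algebra every [x <> top] has [boxes n x = bot] for some
    [n].  If [V] is semisimple, then for all [j] and [k : nat -> nat] some [N]
    makes [□_j p ∨ ⋁_{n ≤ N} □_{k n} ¬ □_n p ≈ 1] hold in [V]: otherwise the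
    counterexamples for the different [N] combine, in their product modulo the
    Fréchet filter, into elements [p] and [q <> 1] with [□_j p ≤ q] and
    [□_{k n} ¬ □_n p ≤ q] for all [n], which no simple quotient separating [q]
    from [1] allows.  Taking [j = 0] and [k] constant gives, for each [k], an
    [N k] with [p ∨ □_k ¬ □_{N k} p ≈ 1].  Taking then [j = 1] and [k = N]
    gives an [M] with [□_1 p ∨ ⋁_{n ≤ M} e_n ≈ 1], where
    [e_n = □_{N n} ¬ □_n p].  The first identity at [¬ □_n p] yields
    [□_n p ≤ □_n ¬ e_n], whence
    [□_M p ≤ □_M (⋀_{n ≤ M} ¬ e_n) ≤ □_M □_1 p = □_{M+1} p]. *)

From Stdlib Require Import Morphisms Relation_Definitions.
From Stdlib Require Import FinFun PeanoNat Lia.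
From Stdlib Require Import Classical ClassicalEpsilon FunctionalExtensionality.
From Stdlib Require Import PropExtensionality ProofIrrelevance.
From mathcomp Require classical_sets.
Require Import Defs.

Set Implicit Arguments.
Unset Strict Implicit.

(** * Order and Heyting implication *)

Definition le (A : modalHeyting) (x y : A) : Prop := meet x y = x.

Definition neg (A : modalHeyting) (x : A) : A := imp x bot.

Section Order.
Variable A : modalHeyting.
Implicit Types x y z w : A.

Lemma meet_idem x : meet x x = x.
Proof. rewrite <- (join_meetK x x) at 2. apply meet_joinK. Qed.

Lemma le_refl x : le x x.
Proof. apply meet_idem. Qed.

Lemma le_trans y x z : le x y -> le y z -> le x z.
Proof.
  unfold le; intros Hxy Hyz. rewrite <- Hxy, <- meetA, Hyz. reflexivity.
Qed.

Lemma le_antisym x y : le x y -> le y x -> x = y.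
Proof. unfold le; intros Hxy Hyx. rewrite <- Hxy, meetC. exact Hyx. Qed.

Lemma meet_lel x y z : le x z -> le (meet x y) z.
Proof.
  intro H. apply (@le_trans x); [|exact H].
  unfold le. rewrite (meetC x y), <- meetA, meet_idem. reflexivity.
Qed.

Lemma meet_ler x y z : le y z -> le (meet x y) z.
Proof. rewrite meetC. apply meet_lel. Qed.

Lemma meet_glb x y z : le z x -> le z y -> le z (meet x y).
Proof. unfold le; intros Hx Hy. rewrite meetA, Hx. exact Hy. Qed.

Lemma le_join_eq x y : le x y <-> join x y = y.
Proof.
  split; unfold le; intro H.
  - rewrite <- H, joinC, meetC. apply join_meetK.
  - rewrite <- H. apply meet_joinK.
Qed.

Lemma join_gel x y z : le z x -> le z (join x y).
Proof. intro H. apply (le_trans H). apply meet_joinK. Qed.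

Lemma join_ger x y z : le z y -> le z (join x y).
Proof. rewrite joinC. apply join_gel. Qed.

Lemma join_lub x y z : le x z -> le y z -> le (join x y) z.
Proof.
  rewrite !le_join_eq; intros Hx Hy. rewrite <- joinA, Hy. exact Hx.
Qed.

Lemma le_top x : le x top.
Proof. apply meet_top. Qed.

Lemma bot_le x : le bot x.
Proof. apply meet_bot. Qed.

Lemma top_le x : le top x -> x = top.
Proof. intro H. apply le_antisym; [apply le_top | exact H]. Qed.

Lemma le_imp x y z : le z (imp x y) <-> le (meet z x) y.
Proof. symmetry. apply imp_residual. Qed.

Lemma le_mp x y z : le z (imp x y) -> le z x -> le z y.
Proof.
  intros Hi Hx. apply (@le_trans (meet z x)).
  - apply meet_glb; [apply le_refl | exact Hx].
  - apply le_imp. exact Hi.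
Qed.

Lemma imp_top x y : imp x y = top <-> le x y.
Proof.
  split; intro H.
  - apply (@le_mp x); [rewrite H; apply le_top | apply le_refl].
  - apply top_le, le_imp, meet_ler, H.
Qed.

Lemma imp_top_antisym x y : imp x y = top -> imp y x = top -> x = y.
Proof. rewrite !imp_top. apply le_antisym. Qed.

(** Case distinction under the assumption [w]: by residuation both cases bound [x] and [y] by
    [imp w z], hence also their join. *)
Lemma le_join_elim x y z w :
  le w (join x y) -> le (meet w x) z -> le (meet w y) z -> le w z.
Proof.
  intros Hj Hx Hy. apply (@le_mp (join x y)); [|exact Hj].
  apply le_imp. rewrite meetC. apply le_imp.
  apply join_lub; apply le_imp; rewrite meetC; assumption.
Qed.

Lemma neg_top x : neg x = top <-> x = bot.
Proof.
  unfold neg. rewrite imp_top. split; intro H.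
  - apply le_antisym; [exact H | apply bot_le].
  - rewrite H. apply le_refl.
Qed.

End Order.

Create HintDb heyting discriminated.
#[local] Hint Resolve le_refl meet_lel meet_ler meet_glb join_gel join_ger
  join_lub le_top bot_le : heyting.

(** * Negation and the modal axiom K *)

Section Modal.
Variable A : modalHeyting.
Implicit Types x y z : A.

Lemma neg_le x y : le x y -> le (neg y) (neg x).
Proof.
  intro H. apply le_imp. apply (@le_mp _ y); [auto with heyting|].
  apply meet_ler, H.
Qed.

Lemma neg_join x y : le (meet (neg x) (neg y)) (neg (join x y)).
Proof.
  apply le_imp. apply (@le_join_elim _ x y).
  - auto with heyting.
  - apply (@le_mp _ x); auto with heyting.
  - apply (@le_mp _ y); auto with heyting.
Qed.

Lemma le_neg_of_join_neg x y : join (neg x) y = top -> le x y.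
Proof.
  intro H. apply (@le_join_elim _ (neg x) y).
  - rewrite H. apply le_top.
  - apply (@le_trans _ bot); [|apply bot_le].
    apply (@le_mp _ x); auto with heyting.
  - auto with heyting.
Qed.

Lemma box_le x y : le x y -> le (box x) (box y).
Proof. unfold le; intro H. rewrite <- box_meet, H. reflexivity. Qed.

Lemma box_imp_box x y : le (box (imp x y)) (imp (box x) (box y)).
Proof.
  apply le_imp. rewrite <- box_meet. apply box_le.
  apply (@le_mp _ x); auto with heyting.
Qed.

End Modal.

(** * Iterated boxes *)

Fixpoint boxes (A : modalHeyting) (n : nat) (x : A) : A :=
  match n with
  | O => x
  | S k => meet (boxes k x) (Nat.iter n (@box A) x)
  end.

Lemma eval_Boxes (A : modalHeyting) (v : nat -> A) n t :
  eval v (Boxes n t) = boxes n (eval v t).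
Proof.
  assert (Hiter : forall m, eval v (Nat.iter m Box t) =
                            Nat.iter m (@box A) (eval v t)).
  { induction m as [|m IH]; simpl; [reflexivity | now rewrite IH]. }
  induction n as [|n IH]; [reflexivity|].
  simpl. rewrite IH, Hiter. reflexivity.
Qed.

Section Boxes.
Variable A : modalHeyting.
Implicit Types x y : A.

Lemma boxes_le_self n x : le (boxes n x) x.
Proof. induction n; simpl; auto with heyting. Qed.

(** Since [box] preserves meets, it raises every exponent in [boxes n x] by one. This recursion
    spares later inductions the iterated boxes. *)
Lemma boxes_S_meet n x : boxes (S n) x = meet x (box (boxes n x)).
Proof.
  induction n as [|n IH]; [reflexivity|].
  change (meet (boxes (S n) x) (box (Nat.iter (S n) (@box A) x)) =
          meet x (box (meet (boxes n x) (Nat.iter (S n) (@box A) x)))).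
  rewrite box_meet, IH, meetA. reflexivity.
Qed.

Lemma boxes_S n x : boxes (S n) x = boxes 1 (boxes n x).
Proof.
  change (boxes 1 (boxes n x)) with (meet (boxes n x) (box (boxes n x))).
  apply le_antisym.
  - apply meet_glb.
    + simpl; auto with heyting.
    + rewrite boxes_S_meet. auto with heyting.
  - rewrite boxes_S_meet. pose proof (boxes_le_self n x). auto with heyting.
Qed.

Lemma boxes_add m n x : boxes (m + n) x = boxes m (boxes n x).
Proof.
  induction m as [|m IH]; [reflexivity|].
  change (S m + n) with (S (m + n)). rewrite boxes_S, IH, <- boxes_S.
  reflexivity.
Qed.

Lemma boxes_le n x y : le x y -> le (boxes n x) (boxes n y).
Proof.
  intro H. induction n as [|n IH]; [exact H|].
  rewrite !(boxes_S n). simpl. pose proof (box_le IH). auto with heyting.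
Qed.

Lemma boxes_anti m n x : m <= n -> le (boxes n x) (boxes m x).
Proof.
  intro H. induction H as [|n H IH]; [apply le_refl|].
  simpl. auto with heyting.
Qed.

Lemma boxes_meet n x y : boxes n (meet x y) = meet (boxes n x) (boxes n y).
Proof.
  apply le_antisym.
  - apply meet_glb; apply boxes_le; auto with heyting.
  - induction n as [|n IH]; [apply le_refl|].
    rewrite !boxes_S_meet. apply box_le in IH. rewrite box_meet in IH.
    apply meet_glb; [auto with heyting|].
    refine (le_trans _ IH). auto with heyting.
Qed.

Lemma boxes_top n : boxes n (@top A) = top.
Proof.
  induction n as [|n IH]; [reflexivity|].
  rewrite boxes_S_meet, IH, box_top. apply meet_idem.
Qed.

End Boxes.

(** * Homomorphisms, quotients and products *)

Lemma hom_eval (A B : modalHeyting) (f : A -> B) (v : nat -> A) t :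
  hom f -> f (eval v t) = eval (fun i => f (v i)) t.
Proof.
  intros [f0 f1 fm fj fi fb fd].
  induction t as [i| | |s IHs t IHt|s IHs t IHt|s IHs t IHt|t IH|t IH]; simpl;
    rewrite ?fm, ?fj, ?fi, ?fb, ?fd; congruence.
Qed.

Lemma hom_boxes (A B : modalHeyting) (f : A -> B) n x :
  hom f -> f (boxes n x) = boxes n (f x).
Proof.
  intro Hf. induction n as [|n IH]; [reflexivity|].
  rewrite !boxes_S_meet, (hom_meet Hf), (hom_box Hf), IH. reflexivity.
Qed.

Lemma hom_neg (A B : modalHeyting) (f : A -> B) x :
  hom f -> f (neg x) = neg (f x).
Proof. intro Hf. unfold neg. now rewrite (hom_imp Hf), (hom_bot Hf). Qed.

Lemma hom_le (A B : modalHeyting) (f : A -> B) x y :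
  hom f -> le x y -> le (f x) (f y).
Proof. unfold le; intros Hf H. now rewrite <- (hom_meet Hf), H. Qed.

(** * Quotient algebras on chosen representatives *)

Section Quotient.
Variables (A : modalHeyting) (theta : relation A).
Hypothesis Htheta : congruence theta.

Definition repr (a : A) : A := epsilon (inhabits bot) (theta a).

Lemma repr_rel a : theta a (repr a).
Proof.
  apply (@epsilon_spec A (inhabits bot) (theta a)).
  exists a. apply (cong_equiv Htheta).
Qed.

(** [epsilon] sees only the predicate [theta a], and related elements have extensionally equal
    predicates. *)
Lemma repr_eq a b : theta a b <-> repr a = repr b.
Proof.
  pose proof (cong_equiv Htheta) as E. split; intro H.
  - unfold repr. replace (theta b) with (theta a); [reflexivity|].
    apply functional_extensionality; intro c.
    apply propositional_extensionality. rewrite H. reflexivity.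
  - rewrite (repr_rel a), H. symmetry. apply repr_rel.
Qed.

(** One representative per class, so that equality in the quotient is Leibniz equality, as the laws
    of [modalHeyting] require. *)
Definition quot_carrier : Type := {a : A | repr a = a}.

Definition quot_of (a : A) : quot_carrier :=
  exist _ (repr a) (eq_sym (proj1 (repr_eq a (repr a)) (repr_rel a))).

Lemma quot_of_eq a b : quot_of a = quot_of b <-> theta a b.
Proof.
  rewrite repr_eq. split; intro H.
  - exact (f_equal (@proj1_sig _ _) H).
  - apply subset_eq_compat. exact H.
Qed.

Lemma quot_of_val (c : quot_carrier) : quot_of (proj1_sig c) = c.
Proof. destruct c as [a Ha]. apply subset_eq_compat. exact Ha. Qed.

Definition lift1 (f : A -> A) (x : quot_carrier) : quot_carrier :=
  quot_of (f (proj1_sig x)).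

Definition lift2 (f : A -> A -> A) (x y : quot_carrier) : quot_carrier :=
  quot_of (f (proj1_sig x) (proj1_sig y)).

Lemma lift1E f a : Proper (theta ==> theta) f ->
  lift1 f (quot_of a) = quot_of (f a).
Proof.
  intro Hf. apply quot_of_eq, Hf. apply quot_of_eq. apply quot_of_val.
Qed.

Lemma lift2E f a b : Proper (theta ==> theta ==> theta) f ->
  lift2 f (quot_of a) (quot_of b) = quot_of (f a b).
Proof.
  intro Hf. apply quot_of_eq, Hf; apply quot_of_eq; apply quot_of_val.
Qed.

Lemma quot_ind (P : quot_carrier -> Prop) :
  (forall a, P (quot_of a)) -> forall c, P c.
Proof. intros H c. rewrite <- quot_of_val. apply H. Qed.

Ltac push_quot_of :=
  rewrite ?(lift2E _ _ (cong_meet Htheta)), ?(lift2E _ _ (cong_join Htheta)),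
    ?(lift2E _ _ (cong_imp Htheta)), ?(lift1E _ (cong_box Htheta)),
    ?(lift1E _ (cong_dia Htheta)).

(* The residuation law is the only one that is not an equation, so it does not
   pass to the quotient automatically. *)
Lemma quot_residual (x y z : A) :
  theta (meet (meet z x) y) (meet z x) <-> theta (meet z (imp x y)) z.
Proof.
  pose proof (cong_equiv Htheta) as E. split; intro H.
  (* This equal form exposes the left side of [H] under the implication. *)
  - replace (meet z (imp x y)) with (meet z (imp x (meet (meet z x) y))).
    + transitivity (meet z (imp x (meet z x))).
      * apply (cong_meet Htheta); [reflexivity|].
        apply (cong_imp Htheta); [reflexivity | exact H].
      * replace (meet z (imp x (meet z x))) with z; [reflexivity|].
        symmetry. apply le_imp. apply le_refl.
    + apply le_antisym; apply meet_glb; auto with heyting; apply le_imp.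
      * apply (@le_trans _ (meet (meet z x) y)); [|auto with heyting].
        apply (@le_mp _ x); auto with heyting.
      * apply meet_glb; [auto with heyting|].
        apply (@le_mp _ x); auto with heyting.
  (* Trade [z] for the related [meet z (imp x y)], whose meet with [x] really lies below [y], then
     trade back. *)
  - transitivity (meet (meet (meet z (imp x y)) x) y).
    + repeat apply (cong_meet Htheta); try reflexivity. symmetry. exact H.
    + replace (meet (meet (meet z (imp x y)) x) y)
        with (meet (meet z (imp x y)) x).
      * apply (cong_meet Htheta); [exact H | reflexivity].
      * symmetry. apply (@le_mp _ x); auto with heyting.
Qed.

Definition quot : modalHeyting.
Proof.
  refine (@ModalHeyting quot_carrier (quot_of bot) (quot_of top)
    (lift2 (@meet A)) (lift2 (@join A)) (lift2 (@imp A))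
    (lift1 (@box A)) (lift1 (@dia A)) _ _ _ _ _ _ _ _ _ _ _ _ _ _ _);
    abstract (
      repeat (refine (quot_ind _); intro); repeat push_quot_of;
      first [ apply f_equal;
              first [ apply meetA | apply meetC | apply joinA | apply joinC
                    | apply meet_joinK | apply join_meetK | apply meet_bot
                    | apply meet_top | apply box_meet | apply box_top
                    | apply dia_join | apply dia_bot | apply box_imp_le
                    | apply dia_imp_le ]
            | rewrite !quot_of_eq; apply quot_residual ]).
Defined.

Lemma quot_of_hom : @hom A quot quot_of.
Proof. split; intros; simpl; push_quot_of; reflexivity. Qed.

Lemma quot_of_surj : Surjective quot_of.
Proof. intro c. exists (proj1_sig c). apply quot_of_val. Qed.

End Quotient.

(** * Products, and closure of varieties under products and quotients *)

Definition prod_alg (I : Type) (B : I -> modalHeyting) : modalHeyting.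
Proof.
  refine (@ModalHeyting (forall i, B i) (fun _ => bot) (fun _ => top)
    (fun x y i => meet (x i) (y i)) (fun x y i => join (x i) (y i))
    (fun x y i => imp (x i) (y i)) (fun x i => box (x i))
    (fun x i => dia (x i)) _ _ _ _ _ _ _ _ _ _ _ _ _ _ _);
    abstract (
      intros;
      first [ split; intro H; apply functional_extensionality_dep; intro i;
              apply (f_equal (fun u => u i)) in H; simpl in H;
              apply imp_residual; exact H
            | apply functional_extensionality_dep; intro i;
              first [ apply meetA | apply meetC | apply joinA | apply joinC
                    | apply meet_joinK | apply join_meetK | apply meet_bot
                    | apply meet_top | apply box_meet | apply box_top
                    | apply dia_join | apply dia_bot | apply box_imp_le
                    | apply dia_imp_le ] ]).
Defined.

Lemma prod_proj_hom (I : Type) (B : I -> modalHeyting) i :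
  @hom (prod_alg B) (B i) (fun x => x i).
Proof. split; reflexivity. Qed.

Lemma variety_prod (V : modalHeyting -> Prop) (I : Type)
    (B : I -> modalHeyting) :
  is_variety V -> (forall i, V (B i)) -> V (prod_alg B).
Proof.
  intros [Sigma HV] HB. apply HV. intros e He v.
  apply functional_extensionality_dep; intro i.
  rewrite !(fun t => hom_eval v t (prod_proj_hom B i)).
  apply HV; [apply HB | exact He].
Qed.

(** A valuation in the quotient lifts to [A] through the representatives, and evaluation commutes
    with the quotient map. *)
Lemma variety_quot (V : modalHeyting -> Prop) (A : modalHeyting)
    (theta : relation A) (Htheta : congruence theta) :
  is_variety V -> V A -> V (quot Htheta).
Proof.
  intros [Sigma HV] HA. apply HV. intros e He v.
  replace v with (fun i => quot_of Htheta (proj1_sig (v i))).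
  - rewrite <- !(fun t => hom_eval (fun i => proj1_sig (v i)) t
                            (quot_of_hom Htheta)).
    f_equal. apply HV; assumption.
  - apply functional_extensionality; intro i. apply quot_of_val.
Qed.

(** * Open filters and simple algebras *)

Record open_filter (A : modalHeyting) (F : A -> Prop) : Prop := OpenFilter {
  of_top : F top;
  of_meet : forall x y, F x -> F y -> F (meet x y);
  of_up : forall x y, le x y -> F x -> F y;
  of_box : forall x, F x -> F (box x)
}.

Definition filter_rel (A : modalHeyting) (F : A -> Prop) : relation A :=
  fun x y => F (imp x y) /\ F (imp y x).

Section Filter.
Variables (A : modalHeyting) (F : A -> Prop).
Hypothesis HF : open_filter F.

Lemma of_up2 x y z : le (meet x y) z -> F x -> F y -> F z.
Proof. intros H Hx Hy. apply (of_up HF H), (of_meet HF); assumption. Qed.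

(** By symmetry one implication per operation suffices. Closure of [F] under [box] settles [box]
    through axiom K and [dia] through the axiom [box_imp_le]. *)
Lemma filter_congruence : congruence (filter_rel F).
Proof.
  split.
  - split.
    + intro x. unfold filter_rel.
      rewrite (proj2 (imp_top x x) (le_refl x)).
      split; apply (of_top HF).
    + intros x y [Hxy Hyx]. split; assumption.
    + assert (T : forall x y z, F (imp x y) -> F (imp y z) -> F (imp x z)).
      { intros x y z. apply of_up2, le_imp. apply (@le_mp _ y).
        - auto with heyting.
        - apply (@le_mp _ x); auto with heyting. }
      intros x y z [Hxy Hyx] [Hyz Hzy]. split; eapply T; eassumption.
  - assert (T : forall x x' y y' : A, F (imp x x') -> F (imp y y') ->
                  F (imp (meet x y) (meet x' y'))).
    { intros x x' y y'. apply of_up2, le_imp, meet_glb.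
      - apply (@le_mp _ x); auto with heyting.
      - apply (@le_mp _ y); auto with heyting. }
    intros x x' [] y y' []. split; apply T; assumption.
  - assert (T : forall x x' y y' : A, F (imp x x') -> F (imp y y') ->
                  F (imp (join x y) (join x' y'))).
    { intros x x' y y'. apply of_up2, le_imp. apply (@le_join_elim _ x y).
      - auto with heyting.
      - apply join_gel, (@le_mp _ x); auto with heyting.
      - apply join_ger, (@le_mp _ y); auto with heyting. }
    intros x x' [] y y' []. split; apply T; assumption.
  - assert (T : forall x x' y y' : A, F (imp x' x) -> F (imp y y') ->
                  F (imp (imp x y) (imp x' y'))).
    { intros x x' y y'. apply of_up2, le_imp, le_imp. apply (@le_mp _ y).
      - auto with heyting.
      - apply (@le_mp _ x); [auto with heyting|].
        apply (@le_mp _ x'); auto with heyting. }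
    intros x x' [] y y' []. split; apply T; assumption.
  - assert (T : forall x x' : A, F (imp x x') -> F (imp (box x) (box x'))).
    { intros x x' H. apply (of_up HF (box_imp_box x x')), (of_box HF), H. }
    intros x x' []. split; apply T; assumption.
  - assert (T : forall x x' : A, F (imp x x') -> F (imp (dia x) (dia x'))).
    { intros x x' H. apply (of_up HF (box_imp_le x x')), (of_box HF), H. }
    intros x x' []. split; apply T; assumption.
Qed.

Lemma filter_rel_top x : filter_rel F x top <-> F x.
Proof.
  split.
  - intros [_ H]. apply (of_up2 (x := imp top x) (y := top)).
    + apply (@le_mp _ top); auto with heyting.
    + exact H.
    + apply (of_top HF).
  - intro H. split.
    + rewrite (proj2 (imp_top x top) (le_top x)). apply (of_top HF).
    + revert H. apply (of_up HF). apply le_imp. auto with heyting.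
Qed.

End Filter.

Lemma eq_congruence (A : modalHeyting) : congruence (@eq A).
Proof. split; try exact _; now repeat intro; subst. Qed.

Lemma total_congruence (A : modalHeyting) :
  congruence (fun _ _ : A => True).
Proof. split; repeat intro; try split; repeat intro; exact I. Qed.

(** The open filter generated by [x] consists of the elements above some [boxes n x]. Its congruence
    relates [x] to [top], so by simplicity it is total and the filter contains [bot]. *)
Lemma simple_boxes_bot (B : modalHeyting) (x : B) :
  simple B -> x <> top -> exists n, boxes n x = bot.
Proof.
  intros (t1 & t2 & _ & _ & _ & H) Hx.
  set (F := fun y : B => exists n, le (boxes n x) y).
  assert (HF : open_filter F).
  { split.
    - exists 0. apply le_top.
    - intros y z [m Hm] [n Hn]. exists (m + n). apply meet_glb.
      + apply (le_trans (boxes_anti x (Nat.le_add_r m n))), Hm.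
      + apply (@le_trans _ (boxes n x)); [|exact Hn].
        apply boxes_anti. lia.
    - intros y z Hyz [n Hn]. exists n. exact (le_trans Hn Hyz).
    - intros y [n Hn]. exists (S n). rewrite boxes_S_meet.
      apply meet_ler, box_le, Hn. }
  assert (HFx : filter_rel F x top)
    by (apply (filter_rel_top HF); exists 0; apply le_refl).
  assert (Hbot : filter_rel F bot top).
  (* Each of three congruences (that of [F], equality, the total one) is [t1] or [t2], so two agree.
     Equality differs from the others at the pair [x], [top]. *)
  { pose proof (H _ (filter_congruence HF)) as D1.
    pose proof (H _ (@eq_congruence B)) as D2.
    pose proof (H _ (@total_congruence B)) as D3.
    unfold relation_equivalence, predicate_equivalence in *; simpl in *.
    assert (filter_rel F x top <-> x = top \/ filter_rel F bot top) as E.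
    { destruct D1 as [D1|D1], D2 as [D2|D2], D3 as [D3|D3];
      pose proof (D1 x top); pose proof (D2 x top); pose proof (D3 x top);
      pose proof (D1 bot top); pose proof (D3 bot top); tauto. }
    tauto. }
  apply (filter_rel_top HF) in Hbot. destruct Hbot as [n Hn].
  exists n. apply le_antisym; [exact Hn | apply bot_le].
Qed.

(** A congruence relating some [x <> top] to [top] relates every [boxes n x], hence [bot], to [top]
    and is total. Otherwise related elements have both implications equal to [top], so they are
    equal. *)
Lemma simple_of_boxes_bot (B : modalHeyting) :
  @bot B <> top -> (forall x : B, x <> top -> exists n, boxes n x = bot) ->
  simple B.
Proof.
  intros Hbt Hx. exists (@eq B), (fun _ _ => True).
  split; [apply eq_congruence|]. split; [apply total_congruence|]. split.
  { intro E. apply Hbt. apply (E bot top). exact I. }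
  intros theta Ht. pose proof (cong_equiv Ht) as E.
  destruct (classic (exists x, x <> top /\ theta x top)) as [[x [Hxt Hth]]|Hn].
  - right. assert (Hbox : forall n, theta (boxes n x) top).
    { induction n as [|n IH]; [exact Hth|].
      rewrite boxes_S_meet, <- (meet_idem top).
      apply (cong_meet Ht Hth). rewrite <- (@box_top B).
      apply (cong_box Ht IH). }
    destruct (Hx x Hxt) as [n Hbn]. specialize (Hbox n). rewrite Hbn in Hbox.
    assert (Hb : forall y, theta y bot).
    { intro y. rewrite <- (meet_top y) at 1.
      rewrite <- (meet_bot y), (meetC bot).
      apply (cong_meet Ht); [reflexivity | symmetry; exact Hbox]. }
    intros y z. split; [trivial|]. intros _. rewrite Hb, (Hb z). reflexivity.
  - left. assert (Himp : forall y z, theta y z -> imp y z = top).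
    { intros y z Hyz. apply NNPP; intro Hne. apply Hn.
      exists (imp y z). split; [exact Hne|].
      rewrite <- (proj2 (imp_top z z) (le_refl z)).
      apply (cong_imp Ht Hyz). reflexivity. }
    intros y z. split.
    + intro Hyz. apply imp_top_antisym; apply Himp; [|symmetry]; exact Hyz.
    + intros ->. reflexivity.
Qed.

(** * The equations imply semisimplicity *)

Lemma open_filter_top (A : modalHeyting) : open_filter (fun x : A => x = top).
Proof.
  split; [reflexivity|..].
  - intros x y -> ->. apply meet_top.
  - intros x y Hxy ->. apply top_le, Hxy.
  - intros x ->. apply box_top.
Qed.

(** Zorn's lemma for the open filters avoiding [d]; by hypothesis the filter containing only [top]
    is one of them. *)
Lemma maximal_open_filter (A : modalHeyting) (d : A) : d <> top ->
  exists F : A -> Prop, open_filter F /\ ~ F d /\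
    forall G : A -> Prop, open_filter G -> (forall x, F x -> G x) ->
      ~ G d -> forall x, G x -> F x.
Proof.
  intro Hd.
  (* The empty chain has union the empty set, which must therefore be allowed. *)
  destruct (@classical_sets.Zorn_bigcup A
    (fun F => (exists x, F x) -> open_filter F /\ ~ F d)) as [F [PF Fmax]].
  - intros C HC Htot [x0 [F0 CF0 F0x0]].
    assert (HX : forall X y, C X -> X y -> open_filter X /\ ~ X d)
      by (intros X y CX Xy; apply (HC X CX); exists y; exact Xy).
    split; [split|].
    + exists F0; [exact CF0 | apply (HX F0 x0 CF0 F0x0)].
    + intros x y [X CX Xx] [Y CY Yy].
      destruct (Htot X Y CX CY) as [XY|YX].
      * exists Y; [exact CY|]. apply (HX Y y CY Yy); [apply XY|]; assumption.
      * exists X; [exact CX|]. apply (HX X x CX Xx); [|apply YX]; assumption.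
    + intros x y Hxy [X CX Xx]. exists X; [exact CX|].
      exact (of_up (proj1 (HX X x CX Xx)) Hxy Xx).
    + intros x [X CX Xx]. exists X; [exact CX|].
      exact (of_box (proj1 (HX X x CX Xx)) Xx).
    + intros [X CX Xd]. apply (HX X d CX Xd). exact Xd.
  (* An empty maximal set would be properly extended by the filter containing only [top]. *)
  - assert (Fne : exists x, F x).
    { apply NNPP; intro Hn. apply (Fmax (fun x => x = top)).
      - split.
        + intros x Fx. destruct Hn. exists x. exact Fx.
        + intro H. apply Hn. exists top. apply H. reflexivity.
      - intros _. split; [apply open_filter_top | exact Hd]. }
    destruct (PF Fne) as [HF Fd]. exists F. split; [exact HF|].
    split; [exact Fd|]. intros G HG FG Gd x Gx. apply NNPP; intro Fx.
    apply (Fmax G).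
    + split; [exact FG|]. intro GF. apply Fx, GF, Gx.
    + intros _. split; assumption.
Qed.

Section Equations.
Variables (A : modalHeyting) (n : nat).
Hypothesis excluded_middle :
  forall x : A, join x (boxes 1 (neg (boxes n x))) = top.
Hypothesis weak_transitivity : forall x : A, le (boxes n x) (boxes (S n) x).

Lemma open_boxes (x : A) : le (boxes n x) (box (boxes n x)).
Proof.
  apply (le_trans (weak_transitivity x)). rewrite boxes_S_meet.
  auto with heyting.
Qed.

Lemma boxes_idem (x : A) : boxes n (boxes n x) = boxes n x.
Proof.
  apply le_antisym; [apply boxes_le_self|].
  (* Only the outer index varies: [boxes n x] is open, so it lies below [boxes m] of itself for
     every [m]. *)
  generalize n at 2; intro m. induction m as [|m IH]; [apply le_refl|].
  rewrite boxes_S_meet. apply meet_glb; [apply le_refl|].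
  apply (le_trans (open_boxes x)), box_le, IH.
Qed.

(** For [z = boxes n x], the excluded middle at [z] itself reads [z ∨ (¬z ∧ □¬z) = 1] by
    idempotence. Weakening gives the first claim, meeting with [¬z] the second. *)
Lemma boxes_complement (x : A) :
  join (boxes n x) (neg (boxes n x)) = top /\
  le (neg (boxes n x)) (box (neg (boxes n x))).
Proof.
  pose proof (excluded_middle (boxes n x)) as H. rewrite boxes_idem in H.
  simpl in H. set (z := boxes n x) in *. split.
  - apply top_le. rewrite <- H. auto with heyting.
  - apply (@le_join_elim _ z (meet (neg z) (box (neg z)))).
    + rewrite H. apply le_top.
    + apply (@le_trans _ bot); [|apply bot_le].
      apply (@le_mp _ z); auto with heyting.
    + auto with heyting.
Qed.

(** If an open [z] is not in [F], maximality puts [imp z d] in [F]. Were this so for both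
    [boxes n x] and its open complement, [d] would be in [F]. *)
Lemma maximal_of_avoiding (F : A -> Prop) (d : A) :
  open_filter F -> ~ F d ->
  (forall G : A -> Prop, open_filter G -> (forall x, F x -> G x) ->
     ~ G d -> forall x, G x -> F x) ->
  forall x, ~ F x -> F (neg (boxes n x)).
Proof.
  intros HF Fd Fmax x Fx.
  assert (Hopen : forall z, le z (box z) -> ~ F z -> F (imp z d)).
  { intros z Hz Fz. apply NNPP; intro Hzd.
    (* This is the filter generated by [F] and [z]; it is closed under [box] because [z] lies below
       [box z]. *)
    apply Fz, (Fmax (fun y => F (imp z y))); [split|..].
    - rewrite (proj2 (imp_top z top) (le_top z)). apply (of_top HF).
    - intros y w. apply (of_up2 HF), le_imp, meet_glb.
      + apply (@le_mp _ z); auto with heyting.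
      + apply (@le_mp _ z); auto with heyting.
    - intros y w Hyw. apply (of_up HF), le_imp.
      apply (@le_trans _ y); [|exact Hyw].
      apply (@le_mp _ z); auto with heyting.
    - intros y Hy. apply (of_box HF), (of_up HF (box_imp_box z y)) in Hy.
      revert Hy. apply (of_up HF), le_imp.
      apply (@le_mp _ (box z)); auto with heyting.
    - intros y. apply (of_up HF), le_imp. auto with heyting.
    - exact Hzd.
    - rewrite (proj2 (imp_top z z) (le_refl z)). apply (of_top HF). }
  destruct (boxes_complement x) as [Hjoin Hneg]. apply NNPP; intro HFn.
  apply Fd. apply (of_up2 HF) with (x := imp (boxes n x) d)
                                   (y := imp (neg (boxes n x)) d).
  - apply (@le_join_elim _ (boxes n x) (neg (boxes n x))).
    + rewrite Hjoin. apply le_top.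
    + apply (@le_mp _ (boxes n x)); auto with heyting.
    + apply (@le_mp _ (neg (boxes n x))); auto with heyting.
  - apply Hopen; [apply open_boxes|].
    intro H. apply Fx, (of_up HF (boxes_le_self n x)), H.
  - apply Hopen; assumption.
Qed.

Lemma separating_filter (d : A) : d <> top ->
  exists F : A -> Prop, open_filter F /\ ~ F d /\
    forall x, ~ F x -> F (neg (boxes n x)).
Proof.
  intro Hd. destruct (maximal_open_filter Hd) as (F & HF & Fd & Fmax).
  exists F. split; [exact HF|]. split; [exact Fd|].
  exact (maximal_of_avoiding HF Fd Fmax).
Qed.

(** There is one simple quotient for each [d <> top], by a filter avoiding [d]. Distinct [a] and [b]
    are separated at [d = imp a b] or [d = imp b a]. *)
Lemma semisimple_of_equations : semisimple A.
Proof.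
  set (F := fun d : {d : A | d <> top} =>
    constructive_indefinite_description _ (separating_filter (proj2_sig d))).
  set (HF := fun d => filter_congruence (proj1 (proj2_sig (F d)))).
  exists {d : A | d <> top}, (fun d => quot (HF d)). split.
  - intro d. destruct (proj2_sig (F d)) as (HFd & Fd & Fmax).
    assert (Htop : forall x, quot_of (HF d) x = @top (quot (HF d)) <->
                             proj1_sig (F d) x)
      by (intro x; rewrite <- (filter_rel_top HFd); apply quot_of_eq).
    apply simple_of_boxes_bot.
    + intro E. apply Htop in E. apply Fd, (of_up HFd (bot_le _) E).
    + intros c. rewrite <- (quot_of_val (HF d) c). generalize (proj1_sig c).
      clear c; intros x Hx. exists n.
      rewrite <- (hom_boxes n x (quot_of_hom (HF d))).
      apply neg_top. rewrite <- (hom_neg _ (quot_of_hom (HF d))).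
      apply Htop, Fmax. rewrite <- Htop. exact Hx.
  - exists (fun a d => quot_of (HF d) a). split; [|split].
    + intro d. apply quot_of_hom.
    + assert (Himp : forall a b : A,
        (fun d => quot_of (HF d) a) = (fun d => quot_of (HF d) b) ->
        imp a b = top).
      { intros a b E. apply NNPP; intro Hne.
        pose (d := exist (fun d => d <> top) (imp a b) Hne).
        apply (f_equal (fun h => h d)) in E. simpl in E.
        apply quot_of_eq in E. apply (proj2_sig (F d)). apply E. }
      intros a b E. apply imp_top_antisym; apply Himp; [|symmetry]; exact E.
    + intro d. apply quot_of_surj.
Qed.

End Equations.

(** * Semisimplicity implies the equations *)

Fixpoint joins (A : modalHeyting) (f : nat -> A) (n : nat) : A :=
  match n with
  | O => f 0
  | S m => join (joins f m) (f n)
  end.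

Lemma le_joins (A : modalHeyting) (f : nat -> A) m n :
  m <= n -> le (f m) (joins f n).
Proof.
  intro H. induction H as [|n H IH].
  - destruct m; simpl; auto with heyting.
  - simpl. auto with heyting.
Qed.

Lemma joins_lub (A : modalHeyting) (f : nat -> A) n x :
  (forall m, m <= n -> le (f m) x) -> le (joins f n) x.
Proof.
  induction n as [|n IH]; intro H; simpl; [apply H; lia|].
  apply join_lub; [apply IH; intros m Hm|]; apply H; lia.
Qed.

(** De Morgan, together with preservation of meets by [boxes m]. *)
Lemma boxes_neg_joins (A : modalHeyting) (f : nat -> A) m n x :
  (forall i, i <= n -> le x (boxes m (neg (f i)))) ->
  le x (boxes m (neg (joins f n))).
Proof.
  induction n as [|n IH]; intro H; simpl; [apply H; lia|].
  apply (le_trans (y := boxes m (meet (neg (joins f n)) (neg (f (S n)))))).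
  - rewrite boxes_meet. apply meet_glb; [apply IH; intros i Hi|]; apply H; lia.
  - apply boxes_le, neg_join.
Qed.

Definition eventually_eq (B : nat -> modalHeyting) : relation (prod_alg B) :=
  fun x y => exists m, forall i, m <= i -> x i = y i.

Lemma eventually_eq_congruence (B : nat -> modalHeyting) :
  congruence (@eventually_eq B).
Proof.
  split.
  - split.
    + intro x. now exists 0.
    + intros x y [m Hm]. exists m. intros i Hi. symmetry. now apply Hm.
    + intros x y z [m Hm] [n Hn]. exists (m + n). intros i Hi.
      rewrite Hm, Hn by lia. reflexivity.
  - intros x x' [m Hm] y y' [n Hn]. exists (m + n). intros i Hi. simpl.
    rewrite Hm, Hn by lia. reflexivity.
  - intros x x' [m Hm] y y' [n Hn]. exists (m + n). intros i Hi. simpl.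
    rewrite Hm, Hn by lia. reflexivity.
  - intros x x' [m Hm] y y' [n Hn]. exists (m + n). intros i Hi. simpl.
    rewrite Hm, Hn by lia. reflexivity.
  - intros x x' [m Hm]. exists m. intros i Hi. simpl. now rewrite Hm.
  - intros x x' [m Hm]. exists m. intros i Hi. simpl. now rewrite Hm.
Qed.

Section Semisimple.
Variable V : modalHeyting -> Prop.
Hypothesis HV : is_variety V.
Hypothesis HS : class_semisimple V.

(** In each simple factor either [p] becomes [top], and the first bound applies, or some [boxes n p]
    becomes [bot], and the bound for this [n] applies. *)
Lemma local_excluded_middle (A : modalHeyting) (j : nat) (k : nat -> nat)
    (p q : A) :
  V A -> le (boxes j p) q ->
  (forall n, le (boxes (k n) (neg (boxes n p))) q) -> q = top.
Proof.
  intros HA Hj Hk. destruct (HS HA) as (I & B & HB & h & Hh & hinj & _).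
  apply hinj. apply functional_extensionality_dep; intro i.
  specialize (Hh i). rewrite (hom_top Hh). apply top_le.
  destruct (classic (h p i = top)) as [E|E].
  - apply (hom_le Hh) in Hj. rewrite (hom_boxes _ _ Hh), E, boxes_top in Hj.
    exact Hj.
  - destruct (simple_boxes_bot (HB i) E) as [n Hn].
    specialize (Hk n). apply (hom_le Hh) in Hk.
    rewrite (hom_boxes _ _ Hh), (hom_neg _ Hh), (hom_boxes _ _ Hh), Hn,
      (proj2 (neg_top bot) eq_refl), boxes_top in Hk.
    exact Hk.
Qed.

Lemma uniform_excluded_middle (j : nat) (k : nat -> nat) :
  exists N, forall A : modalHeyting, V A -> forall p : A,
    join (boxes j p) (joins (fun n => boxes (k n) (neg (boxes n p))) N) = top.
Proof.
  apply NNPP; intro Hno.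
  set (u := fun N (A : modalHeyting) (p : A) =>
    join (boxes j p) (joins (fun n => boxes (k n) (neg (boxes n p))) N)).
  assert (Hex : forall N, exists Ap : {A : modalHeyting & A},
             V (projT1 Ap) /\ u N _ (projT2 Ap) <> top).
  { intro N. apply NNPP; intro H. apply Hno. exists N. intros A HA p.
    apply NNPP; intro Hne. apply H. exists (existT _ A p).
    split; [exact HA | exact Hne]. }
  set (Ap := fun N => constructive_indefinite_description _ (Hex N)).
  set (B := fun N => projT1 (proj1_sig (Ap N))).
  (* Coordinate [N] of [p] is the counterexample for [N], and that of [q] is its failing join. *)
  set (p := (fun N => projT2 (proj1_sig (Ap N))) : prod_alg B).
  set (q := (fun N => u N (B N) (p N)) : prod_alg B).
  assert (Hq : forall N, q N <> top) by (intro N; apply (proj2_sig (Ap N))).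
  set (Q := quot (eventually_eq_congruence B)).
  set (pi := quot_of (eventually_eq_congruence B) : prod_alg B -> Q).
  assert (Hpi : hom pi) by apply quot_of_hom.
  assert (Hle : forall (x y : prod_alg B) m,
    (forall i, m <= i -> le (x i) (y i)) ->
    le (pi x) (pi y)).
  { intros x y m H. unfold le. rewrite <- (hom_meet Hpi).
    apply quot_of_eq. exists m. exact H. }
  assert (Hval : forall n (x : prod_alg B) i, boxes n x i = boxes n (x i))
    by (intros n x i; apply (hom_boxes n x (prod_proj_hom B i))).
  assert (E : pi q = top).
  { apply (@local_excluded_middle Q j k (pi p)).
    - apply variety_quot; [exact HV|]. apply variety_prod; [exact HV|].
      intro N. apply (proj2_sig (Ap N)).
    - rewrite <- (hom_boxes _ _ Hpi). apply (Hle _ _ 0). intros i _.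
      rewrite Hval. apply join_gel, le_refl.
    - intro n.
      rewrite <- (hom_boxes _ _ Hpi), <- (hom_neg _ Hpi),
        <- (hom_boxes _ _ Hpi).
      (* The join at coordinate [i] contains the disjunct of index [n] once [n <= i], which suffices
         modulo the Fréchet filter. *)
      apply (Hle _ _ n). intros i Hi. rewrite Hval.
      change (neg (boxes n p) i) with (neg (boxes n p i)). rewrite Hval.
      apply join_ger.
      exact (le_joins (fun n => boxes (k n) (neg (boxes n (p i)))) Hi). }
  apply quot_of_eq in E. destruct E as [m Hm]. apply (Hq m), Hm, le_n.
Qed.

(** For constant [k] the disjuncts increase with [n], since [boxes n p] decreases; their join is the
    last one. *)
Lemma uniform_excluded_middle_const (k : nat) :
  exists N, forall A : modalHeyting, V A -> forall p : A,
    join p (boxes k (neg (boxes N p))) = top.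
Proof.
  destruct (uniform_excluded_middle 0 (fun _ => k)) as [N HN].
  exists N. intros A HA p. apply top_le. rewrite <- (HN A HA p).
  apply join_lub; [apply join_gel, le_refl|].
  apply join_ger, joins_lub. intros m Hm.
  apply boxes_le, neg_le, boxes_anti, Hm.
Qed.

Lemma uniform_weak_transitivity :
  exists M, forall A : modalHeyting, V A -> forall p : A,
    le (boxes M p) (boxes (S M) p).
Proof.
  set (N := fun k =>
    constructive_indefinite_description _ (uniform_excluded_middle_const k)).
  destruct (uniform_excluded_middle 1 (fun n => proj1_sig (N n))) as [M HM].
  exists M. intros A HA p. specialize (HM A HA p).
  set (e := fun n => boxes (proj1_sig (N n)) (neg (boxes n p))) in HM.
  (* The bound for [k = n], taken at [neg (boxes n p)], has [neg (e n)] under [boxes n]. *)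
  assert (He : forall n, le (boxes n p) (boxes n (neg (e n)))).
  { intro n. apply le_neg_of_join_neg. exact (proj2_sig (N n) A HA _). }
  (* The extra box goes innermost, so that [boxes M] can later be stripped by monotonicity. *)
  rewrite <- Nat.add_1_r, boxes_add.
  apply (le_trans (y := boxes M (neg (joins e M)))).
  - apply boxes_neg_joins. intros n Hn.
    replace M with ((M - n) + n) by lia. rewrite !boxes_add.
    apply boxes_le, He.
  (* Disjunctive syllogism: refuting all [e n] with [n <= M] leaves [boxes 1 p]. *)
  - apply boxes_le. apply (@le_join_elim _ (boxes 1 p) (joins e M)).
    + rewrite HM. apply le_top.
    + auto with heyting.
    + apply (@le_trans _ bot); [|apply bot_le].
      apply (@le_mp _ (joins e M)); auto with heyting.
Qed.

End Semisimple.

Theorem corollary3p52 (V : modalHeyting -> Prop) (HV : is_variety V) :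
  class_semisimple V <->
  exists n : nat,
    class_satisfies V
      (Top ≈ Join (Var 0) (Boxes 1 (Neg (Boxes n (Var 0)))))%mha /\
    class_satisfies V (Boxes n (Var 0) ≤ Boxes (S n) (Var 0))%mha.
Proof.
  split.
  - intro HS.
    destruct (uniform_excluded_middle_const HV HS 1) as [N HN].
    destruct (uniform_weak_transitivity HV HS) as [M HM].
    (* The first identity survives enlarging [N], as [boxes] is antitone in its index; the second
       survives enlarging [M], by applying [boxes N] to both sides. *)
    exists (M + N). split; intros A HA v;
      cbn [fst snd eval]; rewrite !eval_Boxes; cbn [eval Neg];
      rewrite ?eval_Boxes.
    + symmetry. apply top_le. rewrite <- (HN A HA (v 0)).
      apply join_lub; [apply join_gel, le_refl|].
      apply join_ger, boxes_le, neg_le, boxes_anti. lia.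
    + rewrite Nat.add_comm, <- Nat.add_succ_r, !boxes_add.
      apply boxes_le, HM, HA.
  - intros [n [Hem Htr]] A HA. apply (@semisimple_of_equations A n).
    + intro x. specialize (Hem A HA (fun _ => x)).
      cbn [fst snd eval] in Hem. rewrite eval_Boxes in Hem.
      cbn [eval Neg] in Hem. rewrite eval_Boxes in Hem.
      symmetry. exact Hem.
    + intro x. specialize (Htr A HA (fun _ => x)).
      cbn [fst snd eval] in Htr. rewrite !eval_Boxes in Htr. exact Htr.
Qed.
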